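(* Let $q=2^m$ with $m>1$ and let $c_1,c_2,c_3,\gamma\in\mathbb{F}_{q^2}$. Then $$f_2(x)=x+\gamma\,\mathrm{Tr}_q^{q^2}\bigl(c_1x+c_2x^2+c_3x^3+c_3x^{q+2}+x^{2q-1}\bigr)$$ is a permutation polynomial of $\mathbb{F}_{q^2}$ if and only if one of the following holds: (1) $\gamma=0$; (2) $\gamma\in\mathbb{F}_q^{*}$, $c_2,c_3\in\mathbb{F}_q$ and $1+\gamma\,\mathrm{Tr}_q^{q^2}(c_1)=\gamma$; (3) $\gamma\in\mathbb{F}_{q^2}\setminus\mathbb{F}_q$, $m$ is odd, $\gamma^{2q-1}\in\mathbb{F}_q$, $\mathrm{Tr}_q^{q^2}(c_2\gamma^q)=0$, $c_3=0$ and $1+\mathrm{Tr}_q^{q^2}(c_1\gamma)=\gamma^{2q-1}$.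
   Context: $\mathbb{F}_q$ denotes the finite field with $q$ elements and $\mathbb{F}_q^*=\mathbb{F}_q\setminus\{0\}$. $\mathrm{Tr}_q^{q^2}:\mathbb{F}_{q^2}\to\mathbb{F}_q$ is the relative trace $\mathrm{Tr}_q^{q^2}(x)=x+x^q$. A polynomial $f$ over $\mathbb{F}_{q^2}$ is a permutation polynomial of $\mathbb{F}_{q^2}$ if the map $a\mapsto f(a)$ is a bijection of $\mathbb{F}_{q^2}$. *)

(* Defs.v *)
From HB Require Import structures.
From mathcomp Require Import all_boot all_order all_algebra all_field.

Set Implicit Arguments.
Unset Strict Implicit.
Unset Printing Implicit Defensive.

Import GRing.Theory.
Local Open Scope ring_scope.

(* Stated for an arbitrary ring so that it applies both to elements of
   F_{q^2} and, formally, to polynomials over F_{q^2}. *)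
Definition qtrace (R : nzRingType) (q : nat) (x : R) : R := x + x ^+ q.

Definition permutation_poly (R : nzRingType) (p : {poly R}) : Prop :=
  bijective (fun a : R => p.[a]).

Definition f2 (R : nzRingType) (q : nat) (c1 c2 c3 gamma : R) : {poly R} :=
  'X + gamma%:P * qtrace q (c1%:P * 'X + c2%:P * 'X^2 + c3%:P * 'X^3
                            + c3%:P * 'X^(q + 2) + 'X^(2 * q - 1)).

(* Main.v *)
Require Import Defs.
From HB Require Import structures.
From mathcomp Require Import all_boot all_order all_algebra all_field.
From mathcomp Require Import ring zify.

Import GRing.Theory.
Local Open Scope ring_scope.

(** Let T and N denote the trace and the norm from L to F. Since
    c3 x^3 + c3 x^(q+2) = c3 x^2 T(x), the polynomial is x + gamma h(x) with h
    having values in F. It therefore maps each coset x + gamma F into itself,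
    and for gamma <> 0 it is a bijection iff h(x + u gamma) + h(x) + u never
    vanishes for u <> 0 in F ([permutation_criterion]).

    The whole condition becomes explicit over F. Choose w in L with
    w^2 = w + n and w^q = w + 1; then the absolute trace of n is 1, and at
    x = a + b w one has T(x) = b, N(x) = a^2 + a b + n b^2 and
    T(x^(2q-1)) = b + b^3 / N(x), because x^(2q-1) = (x^q)^2 / x off 0.

    For gamma in F a step along F does not change b. Letting b vary forces c2
    and c3 into F. What remains to avoid 0 is a constant a1 plus the fractions
    (v+1) / (y (y + v^2 + v)), with v <> 0 and y of absolute trace 1. These
    avoid the value 1 but assume every other nonzero value ([ratio_neq1],
    [ratio_onto]), so a1 must be 1.

    For gamma outside F choose w proportional to gamma. Homogeneity turns the
    increment into a quadratic polynomial in a scalar u <> 0 whose coefficients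
    depend on the point A + b w. Looking at b = 0, and at b a primitive cube
    root of unity when F has one, shows that its two upper coefficients vanish
    ([irrational_direction], with [tr_inv_not_linear] for odd m). What is left
    is whether e + b^3 / N(A + b w) + (b+1)^3 / N(A + (b+1) w) has a zero, for
    a constant e depending on c1 and gamma. For e = 0 the zeros come from the
    Artin-Schreier equations x^2 + x = n (b^2 + b + 1), so there is none exactly
    when n = 1 and tr 1 = 1; that gives the third case of the classification,
    tr 1 = 1 meaning that m is odd. For e <> 0 there is always a zero
    ([cubic_ratio_onto]): the zeros form a plane quartic stable under
    b -> b + 1, whose quotient is a conic in coordinates (A, x), and a point of
    the conic lifts to a zero over F iff tr (A x) = 0. If there were no zero,
    tr (A x) would be 1 on the whole conic.

    Such extreme configurations are usually excluded by the Weil bound for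
    Kloosterman sums. Here it suffices that tr (u / p) = 1 cannot force
    tr (z p) to be constant unless F has at most 4 elements
    ([tr_inv_not_linear]). Both conditions would cut out sets with half of the
    elements of F, hence the same set, so that inversion would preserve the
    trace up to scaling; applying the Frobenius removes the scaling, and the
    partial fractions of d / (X (X + d)) then give a contradiction. *)

Set Implicit Arguments.
Unset Strict Implicit.

(** * Computing in characteristic 2 *)

Section CharacteristicTwo.

Variable R : comNzRingType.
Hypothesis two0 : (2 : R) = 0.

Lemma char2_3 : (3 : R) = 1.
Proof. by rewrite -[3]/(1 + 2)%:R natrD two0 addr0. Qed.

Lemma char2_4 : (4 : R) = 0.
Proof. by rewrite -[4]/(2 + 2)%:R natrD two0 addr0. Qed.

Lemma char2_5 : (5 : R) = 1.
Proof. by rewrite -[5]/(3 + 2)%:R natrD two0 addr0 char2_3. Qed.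

Lemma char2_6 : (6 : R) = 0.
Proof. by rewrite -[6]/(4 + 2)%:R natrD two0 addr0 char2_4. Qed.

Lemma char2_7 : (7 : R) = 1.
Proof. by rewrite -[7]/(5 + 2)%:R natrD two0 addr0 char2_5. Qed.

Lemma char2_8 : (8 : R) = 0.
Proof. by rewrite -[8]/(6 + 2)%:R natrD two0 addr0 char2_6. Qed.

Lemma char2_N1 : (-1 : R) = 1.
Proof. by apply/eqP; rewrite eq_sym -subr_eq0 opprK -[1 + 1]/2 two0. Qed.

Lemma oppr2 (x : R) : - x = x.
Proof. by rewrite -mulN1r char2_N1 mul1r. Qed.

Lemma addxx (x : R) : x + x = 0.
Proof. by rewrite -{1}(oppr2 x) addNr. Qed.

Lemma addr_eq0E (x y : R) : (x + y == 0) = (x == y).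
Proof. by rewrite addr_eq0 oppr2. Qed.

End CharacteristicTwo.

(* The reflexive ring tactic uses the equation 2 = 0 only on monomials whose
   coefficient is literally 2, so every coefficient that can show up after
   expansion needs an equation of its own. *)
Ltac ring2 h :=
  ring: h (char2_3 h) (char2_4 h) (char2_5 h) (char2_6 h) (char2_7 h)
        (char2_8 h) (char2_N1 h).
Ltac field2 h :=
  field: h (char2_3 h) (char2_4 h) (char2_5 h) (char2_6 h) (char2_7 h)
         (char2_8 h) (char2_N1 h).

(** * The absolute trace *)

Section AbsoluteTrace.

Variables (F : finFieldType) (m : nat).
Hypothesis cardF : #|F| = (2 ^ m)%N.

Lemma degree_gt0 : (0 < m)%N.
Proof. by case: m cardF (finNzRing_gt1 F) => // ->. Qed.

Lemma two_eq0 : (2 : F) = 0.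
Proof.
have := card_finPcharP cardF isT.
by rewrite inE /= => /eqP.
Qed.

Let two0 : (2 : F) = 0 := two_eq0.
Let oppr2 := oppr2 two0.
Let addxx := addxx two0.
Let addr_eq0E := addr_eq0E two0.

Lemma exp2nD i (x y : F) : (x + y) ^+ (2 ^ i) = x ^+ (2 ^ i) + y ^+ (2 ^ i).
Proof.
elim: i x y => [|i IH] x y; first by rewrite !expr1.
rewrite expnS !exprM -IH; congr (_ ^+ _); ring2 two0.
Qed.

Lemma exp_card (x : F) : x ^+ (2 ^ m) = x.
Proof. by rewrite -cardF expf_card. Qed.

Lemma sqr_inj : injective (fun x : F => x ^+ 2).
Proof.
move=> x y /eqP; rewrite -addr_eq0E.
have -> : x ^+ 2 + y ^+ 2 = (x + y) ^+ 2 by ring2 two0.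
by rewrite expf_eq0 /= addr_eq0E => /eqP.
Qed.

Lemma sqrt_exists (x : F) : exists s : F, s ^+ 2 = x.
Proof.
have [g _ gK] := injF_bij sqr_inj.
by exists (g x); rewrite gK.
Qed.

Lemma exists_neq01 : (1 < m)%N -> exists e : F, e != 0 /\ e != 1.
Proof.
move=> m_gt1; suff /existsP[e /andP[e0 e1]] : [exists e : F, (e != 0) && (e != 1)].
  by exists e.
apply: contraLR m_gt1 => /existsPn no_e.
have : (#|F| <= #|[set (0%R : F); 1%R]|)%N.
  apply/subset_leq_card/subsetP => x _; rewrite !inE.
  by have := no_e x; rewrite negb_and !negbK.
rewrite cardF cards2 => /leq_trans /(_ (_ : _ <= 2 ^ 1)%N).
by rewrite leq_exp2l // -leqNgt; apply; case: eqP.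
Qed.

Definition tr (x : F) : F := \sum_(i < m) x ^+ (2 ^ i).

Lemma tr0 : tr 0 = 0.
Proof. by rewrite /tr big1 // => i _; rewrite expr0n -leqn0 leqNgt expn_gt0. Qed.

Lemma trD x y : tr (x + y) = tr x + tr y.
Proof. by rewrite /tr -big_split; apply: eq_bigr => i _; rewrite exp2nD. Qed.

Lemma tr_sqr x : tr (x ^+ 2) = tr x.
Proof.
have m0 := degree_gt0.
rewrite /tr -(prednK m0) big_ord_recr [RHS]big_ord_recl /=.
rewrite -exprM -expnS prednK // exp_card addrC expr1; congr (_ + _).
by apply: eq_bigr => i _; rewrite -exprM -expnS.
Qed.

Lemma sqr_tr x : tr x ^+ 2 = tr x.
Proof.
rewrite -[RHS]tr_sqr /tr.
elim/big_ind2: _ => [|a b c d <- <-|i _]; first by rewrite expr0n.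
  ring2 two0.
by rewrite -!exprM mulnC.
Qed.

Lemma tr_case x : tr x = 0 \/ tr x = 1.
Proof.
have /eqP : tr x * (tr x - 1) = 0 by rewrite mulrBr mulr1 -expr2 sqr_tr subrr.
by rewrite mulf_eq0 subr_eq0 => /orP[] /eqP; [left|right].
Qed.

Lemma tr_neq0 x : tr x <> 0 -> tr x = 1.
Proof. by case: (tr_case x). Qed.

Lemma tr_neq1 x : tr x <> 1 -> tr x = 0.
Proof. by case: (tr_case x). Qed.

(** The trace is a nonzero polynomial function of degree below #|F|. *)
Lemma tr_nontrivial : exists x, tr x = 1.
Proof.
pose p : {poly F} := \sum_(i < m) 'X^(2 ^ i).
have pE x : p.[x] = tr x.
  by rewrite /p horner_sum; apply: eq_bigr => i _; rewrite hornerXn.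
have p_neq0 : p != 0.
  apply/eqP => /(congr1 (fun r : {poly F} => r`_1)).
  rewrite coef0 /p coef_sum -(prednK degree_gt0) big_ord_recl /= coefXn eqxx.
  rewrite big1 ?addr0 => [/eqP|i _]; first by rewrite oner_eq0.
  by rewrite coefXn /= /bump leq0n add1n expnS; case: eqP => //; lia.
have size_p : (size p <= (2 ^ m.-1).+1)%N.
  apply: (leq_trans (size_sum _ _ _)); apply/bigmax_leqP => i _.
  rewrite size_polyXn ltnS leq_exp2l //.
  by rewrite -ltnS prednK ?degree_gt0.
case: (pickP (fun x => tr x == 1)) => [x /eqP|no1]; first by exists x.
have roots : all (root p) (enum F).
  by apply/allP => x _; rewrite /root pE tr_neq1 // => /eqP; rewrite no1.
have := max_poly_roots p_neq0 roots (enum_uniq F).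
rewrite -cardE cardF => /leq_trans /(_ size_p).
rewrite ltnS -{1}(prednK degree_gt0) expnS.
have : (0 < 2 ^ m.-1)%N by rewrite expn_gt0.
lia.
Qed.

Lemma card_tr_eq0 : (#|[set x : F | tr x == 0%R]| * 2 = 2 ^ m)%N.
Proof.
have [t t1] := tr_nontrivial.
have im : [set x | tr x == 1] = [set x + t | x in [set x | tr x == 0]].
  apply/setP => x; rewrite inE; apply/idP/imsetP.
    move=> /eqP x1; exists (x + t); last by rewrite -addrA addxx addr0.
    by rewrite inE trD x1 t1 addxx.
  by case=> y; rewrite inE => /eqP y0 ->; rewrite trD y0 t1 add0r.
have : #|[set x | tr x == 1]| = #|[set x | tr x == 0]|.
  by rewrite im card_imset //; apply: addIr.
have : ~: [set x | tr x == 0] = [set x | tr x == 1].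
  apply/setP => x; rewrite !inE.
  by case: (tr_case x) => ->; rewrite ?eqxx ?oner_eq0 // eq_sym oner_eq0.
have := cardsC [set x : F | tr x == 0]; rewrite cardF => <- -> ->.
by rewrite muln2 addnn.
Qed.

(** Prescribing the value as the trace of some c, rather than as 0 or 1, makes
    every prescribed value attained. *)
Lemma card_tr_mul (k c : F) : k != 0 ->
  (#|[set x : F | tr (k * x)%R == tr c]| * 2 = 2 ^ m)%N.
Proof.
move=> k0; rewrite -card_tr_eq0; congr (_ * 2)%N.
have -> : [set x | tr (k * x) == tr c] =
          [set (x + c) / k | x in [set x | tr x == 0]].
  apply/setP => x; rewrite inE; apply/eqP/imsetP.
    move=> e; exists (k * x + c); first by rewrite inE trD e addxx.
    by rewrite -addrA addxx addr0 mulrAC mulfV // mul1r.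
  case=> y; rewrite inE => /eqP y0 ->.
  by rewrite mulrC divfK // trD y0 add0r.
by rewrite card_imset // => x y /(mulIf (invr_neq0 k0)) /addIr.
Qed.

Lemma card_tr_div (u c : F) : u != 0 ->
  (#|[set p : F | tr (u / p)%R == tr c]| * 2 = 2 ^ m)%N.
Proof.
move=> u0; rewrite -(card_tr_mul c u0); congr (_ * _)%N.
rewrite -[RHS](card_imset _ invr_inj); apply: eq_card => p; rewrite inE.
apply/idP/imsetP => [pS|[r]]; first by exists p^-1; rewrite ?inE ?invrK.
by rewrite inE => ? ->; rewrite invrK.
Qed.

Lemma tr_artin_schreier d : tr (d ^+ 2 + d) = 0.
Proof. by rewrite trD tr_sqr addxx. Qed.

Lemma tr_eq_add0 x y : tr x = tr y -> tr (x + y) = 0.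
Proof. by rewrite trD => ->; rewrite addxx. Qed.

Lemma tr1_neq0 x : tr x = 1 -> x != 0.
Proof. by apply: contra_eq_neq => ->; rewrite tr0 eq_sym oner_eq0. Qed.

Lemma tr_shift1 y w : tr y = 1 -> tr (y + w ^+ 2 + w) = 1.
Proof. by move=> y1; rewrite -addrA trD tr_artin_schreier addr0. Qed.

Lemma tr_artin_schreierD n x : tr n = 1 -> tr (x ^+ 2 + x + n) = 1.
Proof. by move=> n1; rewrite trD tr_artin_schreier add0r. Qed.

(** The additive form of Hilbert's Theorem 90. *)
Lemma hilbert90 x : tr x = 0 -> exists d, d ^+ 2 + d = x.
Proof.
move=> x0; have [t t1] := tr_nontrivial.
(* The solution is the sum, weighted by the conjugates of an element t of
   trace 1, of the partial sums S i of the trace of x; these are shifted by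
   the Frobenius up to x and return to 0 after m steps. *)
pose S i : F := \sum_(j < i) x ^+ (2 ^ j).
have S_sqr i : S i ^+ 2 = S i.+1 + x.
  rewrite /S [X in _ = X + _]big_ord_recl /= expr1 addrAC addxx add0r.
  elim/big_ind2: _ => [|a b c d <- <-|j _]; first by rewrite expr0n.
    exact: (exp2nD 1).
  by rewrite -exprM mulnC -expnS.
exists (\sum_(i < m) S i * t ^+ (2 ^ i)).
have -> : (\sum_(i < m) S i * t ^+ (2 ^ i)) ^+ 2 =
          \sum_(i < m) (S i.+1 + x) * t ^+ (2 ^ i.+1).
  elim/big_ind2: _ => [|a b c d <- <-|j _]; first by rewrite expr0n.
    exact: (exp2nD 1).
  by rewrite exprMn S_sqr -exprM mulnC -expnS.
have -> : \sum_(i < m) (S i.+1 + x) * t ^+ (2 ^ i.+1) =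
          \sum_(i < m) S i.+1 * t ^+ (2 ^ i.+1) + x * tr (t ^+ 2).
  rewrite /tr mulr_sumr -big_split; apply: eq_bigr => i _ /=.
  by rewrite mulrDl -exprM -expnS.
rewrite tr_sqr t1 mulr1 addrAC.
suff -> : \sum_(i < m) S i.+1 * t ^+ (2 ^ i.+1) = \sum_(i < m) S i * t ^+ (2 ^ i).
  by rewrite addxx add0r.
have Sm : S m = 0 by [].
have S0 : S 0%N = 0 by rewrite /S big_ord0.
rewrite -(prednK degree_gt0) big_ord_recr [RHS]big_ord_recl /=.
by rewrite prednK ?degree_gt0 // Sm S0 !mul0r addr0 add0r.
Qed.

Lemma quadratic_root a b c : a != 0 -> b != 0 -> tr (a * c / b ^+ 2) = 0 ->
  exists x, a * x ^+ 2 + b * x + c = 0.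
Proof.
move=> a0 b0 /hilbert90[d ed]; exists (b * d / a).
have -> : a * (b * d / a) ^+ 2 + b * (b * d / a) + c =
          b ^+ 2 / a * (d ^+ 2 + d + a * c / b ^+ 2).
  by field2 two0; apply/andP.
by rewrite ed addxx mulr0.
Qed.

Lemma tr_mul_sqr (k x : F) : tr (k ^+ 2 * x ^+ 2) = tr (k * x).
Proof. by rewrite -exprMn tr_sqr. Qed.

Lemma tr_nondegenerate k : (forall x, tr (k * x) = 0) -> k = 0.
Proof.
move=> tr_k; apply/eqP; apply: contraT => k0.
have [t t1] := tr_nontrivial.
by have /eqP := tr_k (t / k); rewrite mulrC divfK // t1 oner_eq0.
Qed.

(** Since tr (k b^2) = tr (s b) with s^2 = k, the hypothesis and the
    nondegeneracy of the trace form give s = k. *)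
Lemma tr_mul_artin_schreier k :
  (forall b, tr (k * (b ^+ 2 + b)) = 0) -> k = 0 \/ k = 1.
Proof.
move=> tr_k; have [s sk] := sqrt_exists k.
have s_k : s + k = 0.
  apply: tr_nondegenerate => b.
  by rewrite mulrDl trD -(tr_mul_sqr s) sk -trD -mulrDr tr_k.
have /eqP : s * (s + 1) = 0 by rewrite mulrDr mulr1 -expr2 sk addrC.
rewrite mulf_eq0 addr_eq0E => /orP[] /eqP s_val.
  by left; rewrite -sk s_val expr0n.
by right; rewrite -sk s_val expr1n.
Qed.

Lemma tr_neq_addr (x t : F) : tr t = 1 -> tr x != tr (x + t).
Proof.
by move=> t1; rewrite trD t1 eq_sym -subr_eq0 addrAC subrr add0r oner_eq0.
Qed.

(** Evaluate the trace of 1/X + 1/(X+d) = d/(X (X+d)) in two ways: it is tr d by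
    additivity, and inverting it gives the trace of X^2/d + X. Since d is not
    1, the latter is a nonzero linear form in X, which cannot be constant off
    {0, d} in a field with more than 4 elements. *)
Lemma tr_inv_neq_tr : (forall r, tr r^-1 = tr r) -> (m <= 2)%N.
Proof.
move=> tr_inv; have [t t1] := tr_nontrivial.
case: leqP => // m_gt2.
have [e [e0 e1]] := exists_neq01 (ltnW m_gt2).
(* With d a square, tr (X^2/d + X) is tr (l X). *)
pose d := e ^+ 2; pose l := e^-1 + 1.
have l0 : l != 0 by rewrite /l addr_eq0E invr_eq1.
have sub : [set X | tr (l * X) == tr (d + t)] \subset [set 0; d].
  apply/subsetP => X; rewrite !inE -[X == d]addr_eq0E.
  apply: contraTT => /norP[X0 Xd].
  have -> : tr (l * X) = tr d; last exact: tr_neq_addr.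
  have -> : l * X = X + X / e by rewrite /l; ring2 two0.
  have -> : tr (X + X / e) = tr ((X ^+ 2 + d * X) / d).
    have -> : (X ^+ 2 + d * X) / d = (X / e) ^+ 2 + X by rewrite /d; field2 two0.
    by rewrite !trD tr_sqr addrC.
  rewrite -tr_inv.
  have -> : ((X ^+ 2 + d * X) / d)^-1 = X^-1 + (X + d)^-1.
    have d0 : d != 0 by rewrite expf_neq0.
    have XX : X ^+ 2 + d * X != 0.
      have -> : X ^+ 2 + d * X = X * (X + d) by ring2 two0.
      by rewrite mulf_neq0.
    by field2 two0; rewrite Xd X0 d0 XX.
  by rewrite trD !tr_inv trD addrA addxx add0r.
have := subset_leq_card sub; rewrite cards2 => card_le.
have := card_tr_mul (d + t) l0.
have : (2 ^ 3 <= 2 ^ m)%N by rewrite leq_exp2l.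
move=> m8 cardE; move: m8; rewrite -cardE.
have card_le2 := leq_trans card_le (_ : (_ : bool).+1 <= 2)%N.
apply: contraTT => _; rewrite -ltnNge.
by apply: (leq_ltn_trans (leq_mul (card_le2 _) (leqnn 2))); case: (0 != d).
Qed.

(** Each of the two conditions on p holds for half of the field, so the
    implication between them is an equivalence. This is what replaces a bound
    on Kloosterman sums. *)
Lemma tr_inv_not_linear u z c : u != 0 -> z != 0 ->
  (forall p, p != 0 -> tr (u / p) = 1 -> tr (z * p) = c) -> (m <= 2)%N.
Proof.
move=> u0 z0 hyp; have [t t1] := tr_nontrivial.
pose S := [set p | tr (u / p) == tr t]; pose S' := [set p | tr (z * p) == c].
have cardS : (#|S| * 2 = 2 ^ m)%N by apply: card_tr_div.
have sub : S \subset S'.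
  apply/subsetP => p; rewrite !inE t1 => /eqP tr1; apply/eqP/hyp => //.
  by apply: contra_eq_neq tr1 => ->; rewrite invr0 mulr0 tr0 eq_sym oner_eq0.
have [p0 c_p0] : exists p, c = tr p.
  exists (z * (u / t)); apply/esym/eqP.
  suff : u / t \in S' by rewrite inE.
  apply: (subsetP sub); rewrite inE invf_div mulrCA mulfV // mulr1 //.
have cardS' : (#|S'| * 2 = 2 ^ m)%N by rewrite /S' c_p0 card_tr_mul.
have eqSS' : S = S'.
  apply/eqP; rewrite eqEcard sub /= -(leq_pmul2r (isT : 0 < 2)%N).
  by rewrite (eq_leq (etrans cardS' (esym cardS))).
(* The first set does not contain 0, so neither does the second one. *)
have c1 : c = 1.
  rewrite c_p0; apply: tr_neq0 => tr_p0.
  suff : 0 \in S by rewrite inE invr0 mulr0 tr0 t1 eq_sym oner_eq0.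
  by rewrite eqSS' inE mulr0 tr0 c_p0 tr_p0.
have lin p : tr (u / p) = tr (z * p).
  move/setP/(_ p): eqSS'; rewrite !inE t1 c1.
  by case: (tr_case (u / p)) => ->; case: (tr_case (z * p)) => -> //;
     rewrite eqxx ?(eq_sym 0) (negbTE (oner_neq0 _)).
(* Squaring r in tr (1/r) = tr (a r) shows that a is its own square root. *)
pose a := z * u.
have lina r : tr r^-1 = tr (a * r).
  by rewrite /a -mulrA -lin invfM mulrA mulfV // mul1r.
have [s sa] := sqrt_exists a.
have a_s : a + s = 0.
  apply: tr_nondegenerate => r.
  rewrite mulrDl trD -(tr_mul_sqr s) sa -!lina.
  by rewrite -tr_sqr -exprVn addxx.
apply: tr_inv_neq_tr => r; rewrite lina.
suff -> : a = 1 by rewrite mul1r.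
move/eqP: a_s; rewrite addr_eq0E => /eqP e.
have : s * (s + 1) = 0 by rewrite mulrDr -expr2 sa mulr1 -e addxx.
move/eqP; rewrite mulf_eq0 addr_eq0E -e => /orP[] /eqP // a0.
by move: (mulf_neq0 z0 u0); rewrite -/a a0 eqxx.
Qed.

(** * The function governing rational directions *)

Lemma tr_as_conj w z : tr (w * (1 + w) * z) = tr (w ^+ 2 * (z ^+ 2 + z)).
Proof.
have -> : w * (1 + w) * z = w * z + w ^+ 2 * z by ring.
by rewrite trD -tr_mul_sqr -trD -mulrDr.
Qed.

(** If the value were 1, then y / (w (w+1)) would solve an Artin-Schreier
    equation whose right-hand side 1 / (w^2 (w+1)) has the trace of
    1 / (w+1), by partial fractions. Solvability makes this trace 0, whereas
    the solution makes it the trace of y. *)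
Lemma ratio_neq1 y w : tr y = 1 -> w != 0 ->
  (w + 1) / (y * (y + w ^+ 2 + w)) != 1.
Proof.
move=> y1 w0; apply/eqP => e.
have y0 := tr1_neq0 y1.
have y'0 := tr1_neq0 (tr_shift1 w y1).
have {}e : y * (y + w ^+ 2 + w) = 1 + w.
  by rewrite [1 + w]addrC -[RHS](divfK (mulf_neq0 y0 y'0)) e mul1r.
have w1 : 1 + w != 0 by rewrite -e mulf_neq0.
pose z := y / (w * (1 + w)).
have yE : y = w * (1 + w) * z by rewrite /z mulrC divfK ?mulf_neq0.
have zz : z ^+ 2 + z = w^-1 ^+ 2 + w^-1 + (1 + w)^-1.
  have -> : z ^+ 2 + z = (y * (y + w ^+ 2 + w)) / (w * (1 + w)) ^+ 2.
    by rewrite /z; field2 two0; rewrite ?w0 ?w1.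
  by rewrite e; field2 two0; rewrite ?w0 ?w1.
have tr_z : tr (1 + w)^-1 = 0.
  by have := tr_artin_schreier z; rewrite zz trD tr_artin_schreier add0r.
have : tr y = 0.
  rewrite yE tr_as_conj zz -tr_z; congr tr.
  by rewrite /=; field2 two0; rewrite ?w0 ?w1.
by rewrite y1 => /eqP; rewrite oner_eq0.
Qed.

(** As for the value 1, the pairs (y, w) with value r correspond to the w such
    that 1 / (r w^2 (w+1)) has trace 0 and 1 / (r (w+1)) has trace 1. In terms
    of p = 1/w + 1 and k = s^2 + s, with s^2 = 1/r, these are the two
    conditions tr (k p) = 1 and tr (1 / (r p)) = 1 + tr (1/r). *)
Lemma ratio_onto r : r != 0 -> r != 1 ->
  exists y w, [/\ tr y = 1, w != 0 & (w + 1) / (y * (y + w ^+ 2 + w)) = r].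
Proof.
move=> r0 r1; have [t t1] := tr_nontrivial.
have [s sr] := sqrt_exists r^-1.
pose k := s ^+ 2 + s.
have s0 : s != 0 by apply: contraTneq r0 => s0; rewrite -invr_eq0 -sr s0 expr0n eqxx.
have s1 : s + 1 != 0.
  rewrite addr_eq0E; apply: contraNneq r1 => s1.
  by rewrite -invr_eq1 -sr s1 expr1n.
have k0 : k != 0.
  have -> : k = s * (s + 1) by rewrite /k; ring.
  by rewrite mulf_neq0.
have u0 : r^-1 != 0 by rewrite invr_eq0.
(* Each condition is met by half of F. If they were incompatible, the second
   one would therefore be equivalent to tr (k p) = 0, but p = 1 satisfies the
   latter only. *)
have [p kp up] : exists2 p, tr (k * p) = 1 & tr (r^-1 / p) = tr (r^-1 + t).
  pose A := [set p | tr (k * p) == tr 0].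
  pose B := [set p | tr (r^-1 / p) == tr (r^-1 + t)].
  have : ~~ (B \subset A).
    apply/negP => sub; have eqBA : B = A.
      apply/eqP; rewrite eqEcard sub /= -(leq_pmul2r (isT : 0 < 2)%N).
      by rewrite (eq_leq (etrans (card_tr_mul _ k0) (esym (card_tr_div _ u0)))).
    have : 1 \in A by rewrite inE mulr1 /k tr_artin_schreier tr0.
    by rewrite -eqBA inE invr1 mulr1 (negbTE (tr_neq_addr _ t1)).
  case/subsetPn => p; rewrite !inE tr0 => /eqP pB /eqP pA.
  by exists p => //; apply: tr_neq0.
have p0 : p != 0.
  by apply: contra_eq_neq kp => ->; rewrite mulr0 tr0 eq_sym oner_eq0.
have p1 : p + 1 != 0.
  rewrite addr_eq0E; apply: contra_eq_neq kp => ->.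
  by rewrite mulr1 /k tr_artin_schreier eq_sym oner_eq0.
pose w := (p + 1)^-1.
have w0 : w != 0 by rewrite invr_eq0.
have w1 : 1 + w = p * w by rewrite /w; field2 two0.
have w10 : 1 + w != 0 by rewrite w1 mulf_neq0.
have trw : tr (r^-1 / (1 + w)) = 1.
  have -> : r^-1 / (1 + w) = r^-1 + r^-1 / p.
    by rewrite w1 /w; field2 two0; rewrite p1 p0 r0.
  by rewrite trD up trD t1 addrA addxx add0r.
have [z zz] : exists z, z ^+ 2 + z = (r * (w ^+ 2 * (1 + w)))^-1.
  apply: hilbert90.
  have -> : (r * (w ^+ 2 * (1 + w)))^-1 = r^-1 / (1 + w) + ((s / w) ^+ 2 + r^-1 / w).
    have -> : (s / w) ^+ 2 = r^-1 / w ^+ 2 by rewrite -sr; field2 two0.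
    by field2 two0; rewrite ?w0 ?w10 ?r0.
  rewrite trD trw [tr (_ ^+ 2 + _)]trD tr_sqr -trD.
  have -> : s / w + r^-1 / w = k * p + k.
    by rewrite -sr /k /w invrK; ring2 two0.
  by rewrite trD kp /k tr_artin_schreier addr0 addxx.
pose y := w * (1 + w) * z.
have yE : r * (y * (y + w ^+ 2 + w)) = w + 1.
  have -> : r * (y * (y + w ^+ 2 + w)) =
     r * (w * (1 + w)) ^+ 2 * (z ^+ 2 + z) by rewrite /y; ring.
  by rewrite zz; field2 two0; rewrite ?w0 ?w10 ?r0.
exists y, w; split=> //; last first.
  have yy0 : y * (y + w ^+ 2 + w) != 0.
    by apply: contraNneq w10 => y0; rewrite addrC -yE y0 mulr0.
  by rewrite -yE mulfK.
rewrite tr_as_conj zz -[RHS]trw; congr tr.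
by rewrite /=; field2 two0; rewrite ?w0 ?w10 ?r0.
Qed.

Definition qnorm n a b : F := a ^+ 2 + a * b + n * b ^+ 2.

Lemma qnorm_neq0 n a b : tr n = 1 -> b != 0 -> qnorm n a b != 0.
Proof.
move=> n1 b0; have -> : qnorm n a b = b ^+ 2 * ((a / b) ^+ 2 + a / b + n).
  by rewrite /qnorm; field2 two0.
by rewrite mulf_neq0 ?expf_neq0 // tr1_neq0 // tr_artin_schreierD.
Qed.

(** Homogeneity reduces a line at height b to the line at height 1. *)
Lemma line_ratio n b x w : tr n = 1 -> b != 0 ->
  let y := x ^+ 2 + x + n in
  b ^+ 3 / qnorm n (b * x + b * w) b + b ^+ 3 / qnorm n (b * x) b =
  b * w * ((w + 1) / (y * (y + w ^+ 2 + w))).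
Proof.
move=> n1 b0 y; have y1 : tr y = 1 by apply: tr_artin_schreierD.
have y0 := tr1_neq0 y1.
have y'0 := tr1_neq0 (tr_shift1 w y1).
have -> : qnorm n (b * x + b * w) b = b ^+ 2 * (y + w ^+ 2 + w).
  by rewrite /qnorm /y; ring2 two0.
have -> : qnorm n (b * x) b = b ^+ 2 * y by rewrite /qnorm /y; ring2 two0.
by move: y y0 y'0 {y1} => y y0 y'0; field2 two0; rewrite ?b0 ?y0 ?y'0.
Qed.

(** The expression is h(x + v) + h(x) + v / gamma at x = a + b w. *)
Lemma rational_direction n a1 b2 s : (1 < m)%N -> tr n = 1 ->
  (forall a b v, v != 0 ->
     a1 * v + b2 * v ^+ 2 + b * s * v ^+ 2 +
     (b ^+ 3 / qnorm n (a + v) b + b ^+ 3 / qnorm n a b) != 0) <->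
  [/\ a1 = 1, b2 = 0 & s = 0].
Proof.
move=> m_gt1 n1; split; last first.
  move=> [-> -> ->] a b v v0; rewrite !(mul1r, mul0r, mulr0, addr0).
  case: (eqVneq b 0) => [->|b0]; first by rewrite expr0n !mul0r !addr0.
  have -> : a = b * (a / b) by rewrite mulrC divfK.
  have -> : v = b * (v / b) by rewrite mulrC divfK.
  rewrite line_ratio // -[X in X + _]mulr1 -mulrDr mulf_neq0 //.
    by rewrite mulrC divfK.
  rewrite addr_eq0E eq_sym ratio_neq1 ?tr_artin_schreierD //.
  by rewrite mulf_neq0 ?invr_eq0.
move=> H.
have H0 v : v != 0 -> a1 + b2 * v != 0.
  move=> v0; apply: contraNneq (H 0 0 v v0) => e.
  rewrite expr0n !mul0r !addr0.
  have -> : a1 * v + b2 * v ^+ 2 = (a1 + b2 * v) * v by ring.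
  by rewrite e mul0r.
have H1 y b w : tr y = 1 -> b != 0 -> w != 0 ->
    a1 + b2 * b * w + s * b ^+ 2 * w + (w + 1) / (y * (y + w ^+ 2 + w)) != 0.
  move=> y1 b0 w0.
  have [x xE] : exists x, x ^+ 2 + x = y + n.
    by apply: hilbert90; rewrite trD y1 n1 addxx.
  have {xE} -> : y = x ^+ 2 + x + n by rewrite xE -addrA addxx addr0.
  apply: contraNneq (H (b * x) b (b * w) (mulf_neq0 b0 w0)) => e.
  rewrite line_ratio //; apply/eqP; rewrite -[RHS](mulr0 (b * w)) -e; ring.
(* At w = 1 the fraction vanishes. *)
have H2 b : b != 0 -> a1 + b2 * b + s * b ^+ 2 != 0.
  move=> b0; have := H1 n b 1 n1 b0 (oner_neq0 _).
  by rewrite addxx mul0r addr0 !mulr1.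
have b20 : b2 = 0.
  apply/eqP; apply: contraT => b20.
  have a10 : a1 = 0.
    apply/eqP; apply: contraT => a10.
    have := H0 (a1 / b2) (mulf_neq0 a10 (invr_neq0 b20)).
    by rewrite mulrC divfK // addxx eqxx.
  have s0 : s = 0.
    apply/eqP; apply: contraT => s0.
    have := H2 (b2 / s) (mulf_neq0 b20 (invr_neq0 s0)).
    suff -> : a1 + b2 * (b2 / s) + s * (b2 / s) ^+ 2 = 0 by rewrite eqxx.
    by rewrite a10; field2 two0.
  have [w [w0 w1]] := exists_neq01 m_gt1.
  have w10 : w + 1 != 0 by rewrite addr_eq0E.
  pose c := (w + 1) / (n * (n + w ^+ 2 + w)).
  have c0 : c != 0.
    by rewrite !(mulf_neq0, invr_neq0) // tr1_neq0 // tr_shift1.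
  have b0 : c / (b2 * w) != 0 := mulf_neq0 c0 (invr_neq0 (mulf_neq0 b20 w0)).
  have := H1 n _ w n1 b0 w0; rewrite -/c a10 s0.
  have -> : 0 + b2 * (c / (b2 * w)) * w + 0 * (c / (b2 * w)) ^+ 2 * w + c = 0.
    by move: (c) => c'; field2 two0; rewrite b20 w0.
  by rewrite eqxx.
subst b2.
have a10 : a1 != 0 by have := H0 1 (oner_neq0 _); rewrite mul0r addr0.
have s0 : s = 0.
  apply/eqP; apply: contraT => s0.
  have [b bE] := sqrt_exists (a1 / s).
  have b0 : b != 0.
    apply: contraTneq a10 => b0.
    by rewrite -[a1](divfK s0) -bE b0 expr0n mul0r eqxx.
  by have := H2 b b0; rewrite bE mul0r addr0 mulrC divfK // addxx eqxx.
split=> //; apply/eqP; apply: contraT => a11.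
have [y [w [y1 w0 e]]] := ratio_onto a10 a11.
have := H1 y 1 w y1 (oner_neq0 _) w0.
by rewrite e s0 !mul0r !addr0 addxx eqxx.
Qed.

(** * The function governing irrational directions *)

Lemma qnorm_neq0_l n a b : tr n = 1 -> a != 0 -> qnorm n a b != 0.
Proof.
move=> n1 a0; case: (eqVneq b 0) => [->|]; last exact: qnorm_neq0.
by rewrite /qnorm mulr0 expr0n mulr0 !addr0 expf_neq0.
Qed.

Definition cubic_ratio n A b : F :=
  b ^+ 3 / qnorm n A b + (b + 1) ^+ 3 / qnorm n A (b + 1).

Lemma cubic_ratio0 n A : cubic_ratio n A 0 = (A ^+ 2 + A + n)^-1.
Proof.
rewrite /cubic_ratio /qnorm expr0n !mul0r !add0r !expr1n mul1r !mulr1.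
by [].
Qed.

(** Since b -> b + 1 exchanges the two fractions, the numerator is a polynomial
    in A and c = b^2 + b; the coefficient of e is the product of the two norms. *)
Lemma clear_denominators n e A b : tr n = 1 -> A != 0 \/ b ^+ 2 + b != 0 ->
  let c := b ^+ 2 + b in
  let d := A ^+ 2 + n * c in
  let k := A + n in
  e + cubic_ratio n A b = 0 <->
  e * (d ^+ 2 + d * k + c * k ^+ 2) + ((c + 1) * A ^+ 2 + A * c + n * c ^+ 2) = 0.
Proof.
move=> n1 Ac0 c d k.
have [D0 D'0] : qnorm n A b != 0 /\ qnorm n A (b + 1) != 0.
  case: Ac0 => [A0|]; first by rewrite !qnorm_neq0_l.
  have -> : b ^+ 2 + b = b * (b + 1) by ring.
  by rewrite mulf_eq0 negb_or => /andP[b0 b1]; rewrite !qnorm_neq0.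
have -> : e * (d ^+ 2 + d * k + c * k ^+ 2) +
    ((c + 1) * A ^+ 2 + A * c + n * c ^+ 2) =
    qnorm n A b * qnorm n A (b + 1) * (e + cubic_ratio n A b).
  rewrite /cubic_ratio.
  have clear D D' : D != 0 -> D' != 0 ->
      D * D' * (e + (b ^+ 3 / D + (b + 1) ^+ 3 / D')) =
      D * D' * e + b ^+ 3 * D' + (b + 1) ^+ 3 * D.
    by move=> ? ?; field; apply/andP.
  by rewrite clear // /d /k /c /qnorm; ring2 two0.
split=> [->|/eqP]; first by rewrite mulr0.
by rewrite mulf_eq0 (negbTE (mulf_neq0 D0 D'0)) => /eqP.
Qed.

Lemma cubic_ratio_neq0 A b : tr 1 = 1 -> cubic_ratio 1 A b != 0.
Proof.
move=> tr1; apply/eqP => e.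
pose c := b ^+ 2 + b.
have c10 : c + 1 != 0 by apply: tr1_neq0; apply: tr_artin_schreierD.
have [c0|c0] := eqVneq c 0.
  suff : cubic_ratio 1 A b != 0 by rewrite e eqxx.
  have : (b == 0) || (b + 1 == 0).
    by rewrite -mulf_eq0 mulrDr mulr1 -expr2 -/c c0.
  rewrite /cubic_ratio => /orP[]/eqP b0; rewrite ?b0 ?expr0n ?mul0r ?add0r ?addr0.
    by rewrite expr1n mul1r invr_neq0 ?qnorm_neq0 ?oner_neq0.
  have b1 : b = 1 by apply/eqP; rewrite -addr_eq0E b0.
  by rewrite b1 expr1n mul1r invr_neq0 ?qnorm_neq0 ?oner_neq0.
have := @clear_denominators 1 0 A b tr1 (or_intror c0).
rewrite /= -/c add0r mul0r add0r mul1r => -[/(_ e) q0 _].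
have : tr (c + 1) = 0.
  have -> : c + 1 = (A * (c + 1) / c) ^+ 2 + A * (c + 1) / c.
    apply/eqP; rewrite -addr_eq0E; apply/eqP.
    have -> : c + 1 + ((A * (c + 1) / c) ^+ 2 + A * (c + 1) / c) =
        (c + 1) / c ^+ 2 * ((c + 1) * A ^+ 2 + A * c + c ^+ 2) by field2 two0.
    by rewrite q0 mulr0.
  exact: tr_artin_schreier.
by rewrite tr_artin_schreierD // => /eqP; rewrite oner_eq0.
Qed.

(** The quotient of the quartic of zeros by b -> b + 1, in the coordinates A and
    x = (b^2 + b) / A, for e = 1/th. *)
Definition conic n th A x : F :=
  A ^+ 2 + A * (1 + (1 + th) * x) + (n + th) * (n * x ^+ 2 + x + 1).

(** For th = 1 the quadratic part of the conic is a square, so the conic is a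
    parabola, parametrized by t = A + k x with k^2 = n^2 + n. The coordinate x
    does not change under t -> t + 1, so tr (A x) = 1 at both parameters gives
    tr x = 0 for all t; as x is quadratic in t, its leading coefficient is 1,
    and this forces n = 0. *)
Lemma parabola_trace_not_const n : n != 0 -> n != 1 ->
  ~ (forall A x, conic n 1 A x = 0 -> tr (A * x) = 1).
Proof.
move=> n0 n_neq1 trace1.
have [k kE] := sqrt_exists (n ^+ 2 + n).
have k0 : k + n + 1 != 0.
  apply: contraNneq n_neq1; move/eqP; rewrite -addrA addr_eq0E => /eqP k1.
  rewrite -addr_eq0E -[n + 1](addKr (n ^+ 2 + n)) {1}oppr2.
  by apply/eqP; rewrite -{1}kE k1; ring2 two0.
pose r := (k + n + 1)^-1.
pose x t := r * (t ^+ 2 + t + n + 1).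
have onconic t : tr ((t + k * x t) * x t) = 1.
  apply: trace1; rewrite /conic.
  have -> : (t + k * x t) ^+ 2 + (t + k * x t) * (1 + (1 + 1) * x t) +
      (n + 1) * (n * x t ^+ 2 + x t + 1) =
      (k ^+ 2 + (n ^+ 2 + n)) * x t ^+ 2 + (t ^+ 2 + t + n + 1 + (k + n + 1) * x t).
    by move: (x t) => y; ring2 two0.
  rewrite kE addxx mul0r add0r /x /r mulrA mulfV // mul1r.
  by rewrite addxx.
have x_period t : x (t + 1) = x t by rewrite /x; congr (r * _); ring2 two0.
have trx t : tr (x t) = 0.
  have := onconic (t + 1); rewrite x_period.
  have -> : (t + 1 + k * x t) * x t = (t + k * x t) * x t + x t by ring.
  by rewrite trD onconic => /(congr1 (fun y => 1 + y)); rewrite addrA addxx add0r.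
have : r = 0 \/ r = 1.
  apply: tr_mul_artin_schreier => t.
  have -> : r * (t ^+ 2 + t) = x t + x 0 by rewrite /x; ring2 two0.
  by rewrite trD !trx addr0.
case=> r1; first by move/eqP: r1; rewrite invr_eq0 (negbTE k0).
have kn : k = n.
  apply/eqP; rewrite -addr_eq0E -(inj_eq (addIr 1)) add0r -invr_eq1.
  by apply/eqP.
move: kE; rewrite kn => /eqP; rewrite -addr_eq0E addrA addxx add0r.
by rewrite (negbTE n0).
Qed.

(** Above an x for which 1 + (1 + th) x has an inverse p lie two points of the
    conic, or none. Two such values of A add up to 1/p, so tr (x / p) = 0. As
    the trace is invariant under squaring, tr (x / p) takes the form tr (u / p)
    and the condition tr (g p^2) = 0 for the existence of the points becomes one
    on tr (z p). *)
Lemma conic_trace_not_const n th : n + th != 0 -> th != 0 -> th != 1 ->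
  (forall A x, conic n th A x = 0 -> tr (A * x) = 1) -> (m <= 2)%N.
Proof.
move=> nth0 th0 th1 trace1.
have th10 : 1 + th != 0 by rewrite addrC addr_eq0E.
pose s := (1 + th)^-1.
have s0 : s != 0 by rewrite invr_eq0.
have [sg sgE] := sqrt_exists th.
have sg0 : sg != 0 by apply: contraNneq th0 => sg0; rewrite -sgE sg0 expr0n.
have [nu nuE] := sqrt_exists (n + th).
have nu0 : nu != 0 by apply: contraNneq nth0 => nu0; rewrite -nuE nu0 expr0n.
pose u := s * sg; pose z := nu * th * s.
apply: (@tr_inv_not_linear u z (1 + tr ((n + th) * n * s ^+ 2))).
- by rewrite mulf_neq0.
- by rewrite !mulf_neq0.
move=> p p0 up; pose x := (p^-1 + 1) * s.
pose g := (n + th) * (n * x ^+ 2 + x + 1).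
have xE : 1 + (1 + th) * x = p^-1 by rewrite /x /s; field2 two0; rewrite p0 th10.
have gp : tr (g * p ^+ 2) = tr (z * p) + tr ((n + th) * n * s ^+ 2).
  pose al := (n + th) * s ^+ 2 * (n + th + th ^+ 2).
  pose be := (n + th) * s.
  have -> : g * p ^+ 2 = al * p ^+ 2 + be * p + (n + th) * n * s ^+ 2.
    (* This relation makes the coefficient of p^2 a multiple of s^2. *)
    have sE : s = 1 + s ^+ 2 * (th + th ^+ 2) by rewrite /s; field2 two0.
    have -> : g * p ^+ 2 =
        (n + th) * (n * ((1 + p) * s) ^+ 2 + s * p + s * p ^+ 2 + p ^+ 2).
      by rewrite /g /x; field2 two0.
    by rewrite {3}sE /al /be; ring2 two0.
  rewrite trD; congr (_ + _).
  rewrite trD -(tr_sqr (be * p)) -trD -[RHS]tr_sqr; congr tr.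
  rewrite /z !exprMn nuE /al /be; ring2 two0.
suff : tr (g * p ^+ 2) = 1.
  rewrite gp => /(congr1 (fun y => y + tr ((n + th) * n * s ^+ 2))).
  by rewrite -addrA addxx addr0.
apply: tr_neq0 => gp0.
have pi0 : p^-1 != 0 by rewrite invr_eq0.
have [A AE] : exists A, 1 * A ^+ 2 + p^-1 * A + g = 0.
  apply: quadratic_root => //; first exact: oner_neq0.
  by rewrite mul1r exprVn invrK.
have A1 : tr (A * x) = 1.
  by apply: trace1; rewrite /conic xE -AE -/g; ring.
have A2 : tr ((A + p^-1) * x) = 1.
  by apply: trace1; rewrite /conic xE -AE -/g; ring2 two0.
have : tr (u / p) = 0.
  have -> : u / p = u / p + (A * x + (A + p^-1) * x) + x / p by ring2 two0.
  rewrite trD [tr (_ + (_ + _))]trD [tr (A * x + _)]trD A1 A2 addxx addr0.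
  have -> : x / p = s * p^-1 ^+ 2 + s / p by rewrite /x; ring.
  rewrite trD -(tr_sqr (s / p)) -trD -(tr_sqr (u / p)) -trD.
  have -> : (u / p) ^+ 2 + (s * p^-1 ^+ 2 + (s / p) ^+ 2) =
      (s ^+ 2 * sg ^+ 2 + s + s ^+ 2) * p^-1 ^+ 2 by rewrite /u; ring.
  rewrite sgE (_ : _ + _ = 0) ?mul0r ?tr0 //.
  by rewrite /s; field2 two0.
by rewrite up => /eqP; rewrite oner_eq0.
Qed.

(** Suppose that there is no zero. Then the quartic has no point with A = 0 and
    b^2 + b <> 0, none with A <> 0 and b^2 + b = 0, and none with both nonzero;
    for th = 1/e these say in turn that n + th <> 0, that tr th = 0 and that
    tr (A x) = 1 on the conic. The last one leaves only F of order 4, where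
    tr th = 0 means that th is 0 or 1. *)
Lemma cubic_ratio_onto n e : (1 < m)%N -> tr n = 1 -> e != 0 ->
  exists A b, e + cubic_ratio n A b = 0.
Proof.
move=> m_gt1 n1 e0; pose th := e^-1.
have th0 : th != 0 by rewrite invr_eq0.
have n0 := tr1_neq0 n1.
case: (pickP (fun Ab : F * F => e + cubic_ratio n Ab.1 Ab.2 == 0))
    => [[A b] /eqP ?|].
  by exists A, b.
move=> none; exfalso.
pose Q A c := n * (n + th) * c ^+ 2 + A * ((1 + th) * A + n + th) * c +
  A ^+ 2 * (A ^+ 2 + A + n + th).
have Q0 A c : tr c = 0 -> A != 0 \/ c != 0 -> Q A c != 0.
  move=> /hilbert90[b <-] Ac0; apply/eqP => q0.
  have := none (A, b); rewrite /= => /eqP; apply.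
  apply/(clear_denominators e n1 Ac0).
  apply: (mulfI th0); rewrite mulr0 -[RHS]q0 mulrDr mulrA mulVf // mul1r /Q.
  by ring2 two0.
have nth0 : n + th != 0.
  have [f [f0 f1]] := exists_neq01 m_gt1.
  have c0 : f ^+ 2 + f != 0.
    have -> : f ^+ 2 + f = f * (f + 1) by ring.
    by rewrite mulf_neq0 // addr_eq0E.
  have := Q0 0 (f ^+ 2 + f) (tr_artin_schreier f) (or_intror c0).
  apply: contraNneq => nth; rewrite /Q nth mulr0 !mul0r add0r expr0n !mul0r addr0 //.
have trth : tr th = 0.
  case: (tr_case th) => // tr1.
  have [A AE] : exists A, A ^+ 2 + A = n + th.
    by apply: hilbert90; apply: tr_eq_add0; rewrite n1.
  have A0 : A != 0.
    by apply: contraNneq nth0 => A0; rewrite -AE A0 expr0n addr0.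
  have := Q0 A 0 tr0 (or_introl A0).
  have -> : Q A 0 = A ^+ 2 * (A ^+ 2 + A + (n + th)) by rewrite /Q; ring.
  by rewrite AE addxx mulr0 eqxx.
have trace1 A x : conic n th A x = 0 -> tr (A * x) = 1.
  move=> q0; apply: tr_neq0 => Ax.
  have [A0|A0] := eqVneq A 0.
    move: q0; rewrite /conic A0 expr0n mul0r !add0r => /eqP.
    rewrite mulf_eq0 (negbTE nth0) /= => /eqP q0.
    have : tr ((n * x) ^+ 2 + n * x + n) = 1 by rewrite tr_artin_schreierD.
    have -> : (n * x) ^+ 2 + n * x + n = n * (n * x ^+ 2 + x + 1) by ring.
    by rewrite q0 mulr0 tr0 => /eqP; rewrite eq_sym oner_eq0.
  have /eqP := Q0 A (A * x) Ax (or_introl A0); apply.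
  have -> : Q A (A * x) = A ^+ 2 * conic n th A x by rewrite /Q /conic; ring.
  by rewrite q0 mulr0.
have [th1|th1] := eqVneq th 1.
  have n_neq1 : n != 1 by rewrite -addr_eq0E -th1.
  by move: trace1; rewrite th1; apply: parabola_trace_not_const.
have th10 : 1 + th != 0 by rewrite addrC addr_eq0E.
have m2 : m = 2.
  by apply/eqP; rewrite eqn_leq m_gt1 (conic_trace_not_const nth0 th0 th1 trace1).
move: trth; rewrite /tr m2 !big_ord_recl big_ord0 /= addr0 expr1 => /eqP.
have -> : th + th ^+ 2 = th * (1 + th) by ring.
by rewrite mulf_eq0 (negbTE th0) (negbTE th10).
Qed.

Lemma cubic_ratio_not_const n e : (1 < m)%N -> tr n = 1 ->
  ~ (forall A, e + cubic_ratio n A 0 = 0).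
Proof.
move=> m_gt1 n1 zero; have [f [f0 f1]] := exists_neq01 m_gt1.
have := etrans (zero f) (esym (zero 0)); rewrite !cubic_ratio0 => /addrI inv_eq.
have {inv_eq} /addIr := invr_inj inv_eq.
rewrite expr0n addr0 => /eqP.
have -> : f ^+ 2 + f = f * (f + 1) by ring.
by rewrite mulf_eq0 addr_eq0E (negbTE f0) (negbTE f1).
Qed.

(** If 1 had trace 0, then A = n and b^2 + b = 1 would give a zero. Hence
    b^2 + b + 1 <> 0 for all b, and for b outside {0, 1} a zero over b exists iff
    n (b^2 + b + 1) has trace 0. So n (b^2 + b) has trace 0 for all b. *)
Lemma cubic_ratio_neq0_inv n : (1 < m)%N -> tr n = 1 ->
  (forall A b, cubic_ratio n A b != 0) -> n = 1.
Proof.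
move=> m_gt1 n1 never0; have n0 := tr1_neq0 n1.
have poly A c : tr c = 0 -> A != 0 \/ c != 0 ->
    (c + 1) * A ^+ 2 + A * c + n * c ^+ 2 != 0.
  move=> /hilbert90[b <-] Ac0; apply: contraNneq (never0 A b) => q0.
  apply/eqP; rewrite -[LHS]add0r; apply/(clear_denominators 0 n1 Ac0).
  by rewrite mul0r add0r.
have tr1 : tr 1 = 1.
  apply: tr_neq0 => tr1; have := poly n 1 tr1 (or_introl n0).
  by rewrite addxx mul0r add0r expr1n !mulr1 addxx eqxx.
case: (@tr_mul_artin_schreier n); last by [].
  move=> b; apply: tr_neq1 => tr_b; set c := b ^+ 2 + b in tr_b.
  have trc : tr c = 0 by apply: tr_artin_schreier.
  have c0 : c != 0.
    by apply: contra_eq_neq tr_b => ->; rewrite mulr0 tr0 eq_sym oner_eq0.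
  have c10 : c + 1 != 0 by rewrite tr1_neq0 // trD trc tr1 add0r.
  have [x xE] : exists x, x ^+ 2 + x = n * (c + 1).
    by apply: hilbert90; rewrite mulrDr mulr1 trD tr_b n1 addxx.
  have /eqP := poly (x * c / (c + 1)) c trc (or_intror c0); apply.
  have -> : (c + 1) * (x * c / (c + 1)) ^+ 2 + x * c / (c + 1) * c + n * c ^+ 2 =
      c ^+ 2 / (c + 1) * (x ^+ 2 + x + n * (c + 1)) by field2 two0.
  by rewrite xE addxx mulr0.
by move/eqP; rewrite (negbTE n0).
Qed.

(** The expression is, up to the factor u, the one that must not vanish at the
    point u (A + b w). On the line b = 0 the points A and A + 1 share the value
    of the cubic ratio, but not that of s A^2 + k when s <> 0. *)
Lemma irrational_direction n e B s k : (1 < m)%N -> tr n = 1 ->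
  (forall A b u, u != 0 ->
     e + cubic_ratio n A b + u * B
       + u ^+ 2 * (s * A ^+ 2 + k * (b ^+ 2 + b + 1)) != 0) <->
  [/\ e = 0, n = 1, B = 0 & s = 0 /\ k = 0].
Proof.
move=> m_gt1 n1; split; last first.
  move=> [-> n_1 -> [-> ->]] A b u u0; rewrite n_1 in n1 *.
  by rewrite !mul0r !addr0 !mulr0 add0r !addr0 cubic_ratio_neq0.
move=> H.
have s0 : s = 0.
  apply/eqP; apply: contraT => s0.
  have [A AE] := sqrt_exists (k / s).
  have {AE} CA : s * A ^+ 2 = k by rewrite AE mulrC divfK.
  pose E := e + cubic_ratio n A 0.
  have H0 u : u != 0 -> E + u * B != 0.
    move=> /(H A 0 u); rewrite -/E CA expr0n !add0r mulr1 addxx mulr0 addr0 //.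
  have H1 u : u != 0 -> E + u * B + u ^+ 2 * s != 0.
    move=> /(H (A + 1) 0 u).
    have -> : cubic_ratio n (A + 1) 0 = cubic_ratio n A 0.
      by rewrite !cubic_ratio0; congr (_^-1); ring2 two0.
    rewrite -/E; congr (_ + _ * _ != 0).
    rewrite -[RHS]addr0 -(addxx k) -{1}CA; ring2 two0.
  have [B0|B0] := eqVneq B 0.
    have E0 : E != 0 by have := H0 1 (oner_neq0 _); rewrite B0 mulr0 addr0.
    have [u uE] := sqrt_exists (E / s).
    have u0 : u != 0.
      apply: contraNneq E0 => u0.
      by rewrite -[E](divfK s0) -uE u0 expr0n mul0r.
    by have := H1 u u0; rewrite B0 uE mulr0 addr0 divfK // addxx eqxx.
  have E0 : E = 0.
    apply/eqP; apply: contraT => E0.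
    have := H0 _ (mulf_neq0 E0 (invr_neq0 B0)).
    by rewrite divfK // addxx eqxx.
  have := H1 _ (mulf_neq0 B0 (invr_neq0 s0)).
  suff -> : E + B / s * B + (B / s) ^+ 2 * s = 0 by rewrite eqxx.
  by rewrite E0; field2 two0.
have {}H A b u : u != 0 ->
    e + cubic_ratio n A b + u * B + u ^+ 2 * (k * (b ^+ 2 + b + 1)) != 0.
  by move=> /(H A b u); rewrite s0 mul0r add0r.
have linear_part b : k * (b ^+ 2 + b + 1) = 0 -> B != 0 ->
    forall A, e + cubic_ratio n A b = 0.
  move=> k0 B0 A; apply/eqP; apply: contraT => E0.
  have := H A b _ (mulf_neq0 E0 (invr_neq0 B0)).
  by rewrite k0 mulr0 addr0 divfK // addxx eqxx.
have k0 : k = 0.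
  apply/eqP; apply: contraT => k0.
  have [B0|B0] := eqVneq B 0.
    case: (@cubic_ratio_not_const n e m_gt1 n1) => A.
    apply/eqP; apply: contraT => E0.
    have [u uE] := sqrt_exists ((e + cubic_ratio n A 0) / k).
    have u0 : u != 0.
      apply: contraNneq E0 => u0.
      by rewrite -[_ + _](divfK k0) -uE u0 expr0n mul0r.
    have := H A 0 u u0.
    by rewrite B0 mulr0 expr0n !(addr0, add0r) mulr1 uE divfK // addxx eqxx.
  (* If 1 has trace 0, take b to be a primitive cube root of unity w, where
     the quadratic coefficient vanishes for all A. If 1 has trace 1, then on
     b = 0 the absence of roots u says that a linear form in 1/y has constant
     trace while y runs through the elements of trace 1; then F can
     only have order 4, where the trace of 1 is 0. *)
  case: (tr_case 1) => tr1.
    have [w wE] := hilbert90 tr1.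
    have w2 : k * (w ^+ 2 + w + 1) = 0 by rewrite wE addxx mulr0.
    have c0 : w ^+ 2 + w != 0 by rewrite wE oner_neq0.
    have val A := (clear_denominators e n1 (or_intror c0)).1 (linear_part w w2 B0 A).
    have {}val A : e * ((A ^+ 2 + n) ^+ 2 + (A ^+ 2 + n) * (A + n) + (A + n) ^+ 2) +
        (A + n) = 0.
      by have := val A; rewrite /= wE => val_A; rewrite -[RHS]val_A; ring2 two0.
    have nn0 : n * (n + 1) != 0.
      apply: mulf_neq0; rewrite ?addr_eq0E; first exact: tr1_neq0.
      by apply: contra_eq_neq tr1 => <-; rewrite n1 oner_neq0.
    have /eqP e0 : e == 0.
      have : e * (n * (n + 1)) ^+ 2 = 0 by rewrite -[RHS](val n); ring2 two0.
      by move/eqP; rewrite mulf_eq0 expf_eq0 (negbTE nn0) andbF orbF.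
    have := val (n + 1); rewrite e0 mul0r add0r addrAC addxx add0r => /eqP.
    by rewrite oner_eq0.
  have H0 A u : u != 0 -> e + cubic_ratio n A 0 + u * B + u ^+ 2 * k != 0.
    by move=> u0; have := H A 0 u u0; rewrite expr0n !add0r mulr1.
  have E0 A : e + cubic_ratio n A 0 != 0.
    apply/eqP => E0; have := H0 A _ (mulf_neq0 B0 (invr_neq0 k0)).
    suff -> : e + cubic_ratio n A 0 + B / k * B + (B / k) ^+ 2 * k = 0.
      by rewrite eqxx.
    by rewrite E0; field2 two0.
  have tr_kE A : tr (k * (e + cubic_ratio n A 0) / B ^+ 2) = 1.
    apply: tr_neq0 => /(quadratic_root k0 B0) [u uE].
    have u0 : u != 0.
      apply: contraNneq (E0 A) => u0.
      by move: uE; rewrite u0 expr0n !mulr0 !add0r => ->.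
    have /eqP := H0 A u u0; apply; rewrite -[RHS]uE; ring.
  have m2 : (m <= 2)%N.
    apply: (@tr_inv_not_linear 1 (k / B ^+ 2) (1 + tr (k * e / B ^+ 2))).
    - exact: oner_neq0.
    - by rewrite mulf_neq0 ?invr_neq0 ?expf_neq0.
    move=> p p0; rewrite mul1r => tr_p.
    have [A AE] : exists A, A ^+ 2 + A = p^-1 + n.
      by apply: hilbert90; rewrite trD tr_p n1 addxx.
    have := tr_kE A; rewrite cubic_ratio0 AE -addrA addxx addr0 invrK => <-.
    by rewrite -trD; congr tr; ring2 two0.
  have {}m2 : m = 2 by apply/eqP; rewrite eqn_leq m2.
  move: tr1; rewrite /tr m2 !big_ord_recl big_ord0 /= addr0 !expr1n addxx.
  by move/eqP; rewrite eq_sym oner_eq0.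
have B0 : B = 0.
  apply/eqP; apply: contraT => B0.
  case: (@cubic_ratio_not_const n e m_gt1 n1); apply: linear_part => //.
  by rewrite k0 mul0r.
have never0 A b : e + cubic_ratio n A b != 0.
  have := H A b 1 (oner_neq0 _).
  by rewrite B0 k0 !mul0r !mulr0 !addr0.
have e0 : e = 0.
  apply/eqP; apply: contraT => e0.
  have [A [b /eqP]] := cubic_ratio_onto m_gt1 n1 e0.
  by rewrite (negbTE (never0 A b)).
split=> //; apply: cubic_ratio_neq0_inv => // A b.
by have := never0 A b; rewrite e0 add0r.
Qed.

End AbsoluteTrace.
(** * Coordinates on the quadratic extension *)

Section QuadraticExtension.

Variables (F : finFieldType) (m : nat).
Hypothesis cardF : #|F| = (2 ^ m)%N.
Variable L : fieldExtType F.
Hypothesis dimL : \dim {: L} = 2%N.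

Local Notation q := (2 ^ m)%N.
Variable inL : {rmorphism F -> L}.
Hypothesis inLE : forall a, inL a = a%:A.
Local Notation "a %:L" := (inL a) (at level 1, format "a %:L").
Local Notation tr := (@tr F m).

Let two0 : (2 : L) = 0.
Proof. by rewrite -(rmorph_nat inL 2) (two_eq0 cardF) rmorph0. Qed.
Let addxx := @addxx L two0.
Let addr_eq0E := @addr_eq0E L two0.

Lemma inL_inj : injective inL.
Proof. exact: fmorph_inj. Qed.

Lemma inL_mem (a : F) : a%:L \in 1%VS.
Proof. by rewrite inLE memvZ ?mem1v. Qed.

Lemma mem_fixed (x : L) : (x \in 1%VS) = (x ^+ q == x).
Proof.
by rewrite (@Fermat's_little_theorem F L 1%AS) dimv1 expn1 cardF.
Qed.

Lemma inL_frob (a : F) : a%:L ^+ q = a%:L.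
Proof. by apply/eqP; rewrite -mem_fixed inL_mem. Qed.

Lemma frobD (x y : L) : (x + y) ^+ q = x ^+ q + y ^+ q.
Proof.
elim: m x y => [|i IH] x y; first by rewrite !expr1.
by rewrite expnS !exprM -IH; congr (_ ^+ _); ring2 two0.
Qed.

Lemma frobK (x : L) : (x ^+ q) ^+ q = x.
Proof.
have := memvf x; rewrite (@Fermat's_little_theorem F L {:L}%AS) dimL cardF.
by rewrite -exprM => /eqP.
Qed.

(** The trace as an element of F, where linear algebra over F is direct. *)
Definition trF (x : L) : F := odflt 0 [pick a | a%:L == qtrace q x].

Lemma trFE x : (trF x)%:L = x + x ^+ q.
Proof.
rewrite /trF /qtrace; case: pickP => [a /eqP //|none].
have : x + x ^+ q \in 1%VS by rewrite mem_fixed frobD frobK addrC.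
by case/vlineP => a xE; have := none a; rewrite /= inLE xE eqxx.
Qed.

Lemma trFD (x y : L) : trF (x + y) = trF x + trF y.
Proof. by apply: inL_inj; rewrite rmorphD /= !trFE frobD addrACA. Qed.

Lemma trFZ (a : F) (x : L) : trF (a%:L * x) = a * trF x.
Proof. by apply: inL_inj; rewrite rmorphM /= !trFE exprMn inL_frob -mulrDr. Qed.

Lemma trF_eq0 (x : L) : (trF x == 0) = (x \in 1%VS).
Proof.
by rewrite mem_fixed -(inj_eq inL_inj) trFE rmorph0 addr_eq0E eq_sym.
Qed.

Lemma trFZr (a : F) (x : L) : trF (x * a%:L) = a * trF x.
Proof. by rewrite mulrC trFZ. Qed.

Lemma exists_irrational : exists z : L, z \notin 1%VS.
Proof.
suff /subvPn [z _ z1] : ~~ ({: L} <= 1)%VS by exists z.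
by apply/negP => /dimvS; rewrite dimL dimv1.
Qed.

Lemma span_irrational (g x : L) : g \notin 1%VS -> exists a b, x = a%:L + b%:L * g.
Proof.
move=> g1; have full : (1 + <[g]>)%VS = fullv.
  apply/eqP; rewrite eqEdim subvf dimL.
  have /ltn_leqif := dimv_leqif_sup (addvSl 1 <[g]>).
  rewrite dimv1 => ->; apply: contra g1 => /subvP; apply.
  by rewrite (subvP (addvSr _ _)) // memv_line.
have := memvf x; rewrite -full => /memv_addP[u /vlineP[a ->] [v /vlineP[b ->] ->]].
by exists a, b; rewrite !inLE mulr_algl.
Qed.

(** Generators w for which the conjugate of a + b w is a + b + b w. *)
Definition artin_schreier_gen (w : L) (n : F) :=
  [/\ w \notin 1%VS, w ^+ 2 = w + n%:L, w ^+ q = w + 1 & tr n = 1].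

(** Write g^2 = a + t g. Here t <> 0, since every element of F is a square in F
    and g would lie in F otherwise; so w = g / t satisfies w^2 = w + n. Its
    conjugate is the other root of this equation, and n has trace 1 because
    the equation has no root in F. *)
Lemma irrational_scaled (g : L) : g \notin 1%VS ->
  exists t w n, [/\ t != 0, g = t%:L * w & artin_schreier_gen w n].
Proof.
move=> g1; have [a [t g2]] := span_irrational (g ^+ 2) g1.
have t0 : t != 0.
  apply: contraNneq g1 => t0; have [d dE] := sqrt_exists cardF a.
  suff -> : g = d%:L by apply: inL_mem.
  apply/eqP; rewrite -addr_eq0E -sqrf_eq0; apply/eqP.
  have -> : (g + d%:L) ^+ 2 = g ^+ 2 + (d ^+ 2)%:L by rewrite rmorphXn; ring2 two0.
  by rewrite g2 t0 dE rmorph0 mul0r addr0 addxx.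
pose w := t^-1%:L * g; pose n := a / t ^+ 2.
have tw : g = t%:L * w by rewrite /w mulrA -rmorphM mulfV // rmorph1 mul1r.
have w1 : w \notin 1%VS.
  by apply: contra g1 => w1; rewrite tw rpredM ?inL_mem.
have w2 : w ^+ 2 = w + n%:L.
  have tL0 : t%:L != 0 by rewrite fmorph_eq0.
  have nt : t%:L ^+ 2 * n%:L = a%:L.
    by rewrite -rmorphXn -rmorphM /n mulrC divfK ?expf_neq0.
  apply: (mulfI (expf_neq0 2 tL0)).
  by rewrite mulrDr nt -exprMn -tw g2 expr2 -mulrA -tw addrC.
have wq : w ^+ q = w + 1.
  have sq : (w ^+ q) ^+ 2 = w ^+ q + n%:L.
    by rewrite -exprM mulnC exprM w2 frobD inL_frob.
  have : (w ^+ q + w) * (w ^+ q + w + 1) = 0.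
    have -> : (w ^+ q + w) * (w ^+ q + w + 1) =
              (w ^+ q) ^+ 2 + w ^+ q + (w ^+ 2 + w).
      by ring2 two0.
    by rewrite sq w2; ring2 two0.
  move/eqP; rewrite mulf_eq0 addr_eq0E -mem_fixed (negbTE w1) /=.
  by rewrite -addrA addr_eq0E => /eqP.
exists t, w, n; split=> //; split=> //.
apply: (tr_neq0 cardF) => /(hilbert90 cardF)[d dE].
have : (w + d%:L) * (w + (d + 1)%:L) = 0.
  have -> : (w + d%:L) * (w + (d + 1)%:L) = w ^+ 2 + w + (d ^+ 2 + d)%:L.
    by rewrite !rmorphD rmorphXn rmorph1; ring2 two0.
  by rewrite dE w2; ring2 two0.
move/eqP; rewrite mulf_eq0 !addr_eq0E => /orP[]/eqP wE.
  by move: w1; rewrite wE inL_mem.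
by move: w1; rewrite wE inL_mem.
Qed.

Section Coordinates.

Variables (w : L) (n : F).
Hypothesis w_gen : artin_schreier_gen w n.

Lemma trF_coord (a b : F) : trF (a%:L + b%:L * w) = b.
Proof.
case: w_gen => _ _ wq _; rewrite trFD trFZ.
have /eqP -> : trF a%:L == 0 by rewrite trF_eq0 inL_mem.
suff -> : trF w = 1 by rewrite add0r mulr1.
by apply: inL_inj; rewrite trFE wq rmorph1 addrA addxx add0r.
Qed.

(** For x <> 0 the trace is (x^3 + y^3) / (x y) with y = x^q = x + b. *)
Lemma trF_tail (a b : F) :
  trF ((a%:L + b%:L * w) ^+ (2 * q - 1)) = b + b ^+ 3 / qnorm n a b.
Proof.
set x := _ + _; case: w_gen => w1 w2 wq n1.
have q0 : (0 < q)%N by rewrite expn_gt0.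
have [x0|x0] := eqVneq x 0.
  have := trF_coord a b; rewrite -/x x0 expr0n.
  have -> : (2 * q - 1 == 0)%N = false by lia.
  move=> <-; have /eqP -> : trF 0 == 0 by rewrite trF_eq0 mem0v.
  by rewrite expr0n mul0r addr0.
have xq : x ^+ q = x + b%:L by rewrite -(trF_coord a b) -/x trFE addrA addxx add0r.
have normE : (qnorm n a b)%:L = x * (x + b%:L).
  rewrite /qnorm /x.
  have -> : (a%:L + b%:L * w) * (a%:L + b%:L * w + b%:L) =
     a%:L ^+ 2 + a%:L * b%:L + b%:L ^+ 2 * (w ^+ 2 + w) by ring2 two0.
  by rewrite w2; ring2 two0.
have y0 : x + b%:L != 0 by rewrite -xq expf_neq0.
have tail (y : L) : y != 0 -> y ^+ (2 * q - 1) = (y ^+ q) ^+ 2 / y.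
  move=> y0'; apply: (mulIf y0'); rewrite divfK // -exprSr -exprM mulnC.
  by congr (_ ^+ _); lia.
apply: inL_inj; rewrite trFE exprAC xq !tail // -{1}xq frobK xq.
rewrite rmorphD fmorph_div normE rmorphXn.
by field2 two0; rewrite x0 y0.
Qed.

Lemma coordinates x : exists a b, x = a%:L + b%:L * w.
Proof. by case: w_gen => w1 _ _ _; apply: span_irrational. Qed.

End Coordinates.

(** * The permutation criterion *)

Section Criterion.

Variables c1 c2 c3 : L.

(** The trace occurring in f2, once c3 x^3 + c3 x^(q+2) is written as
    c3 x^2 T(x). *)
Definition f2_trace x : F :=
  trF (c1 * x) + trF (c2 * x ^+ 2) + trF x * trF (c3 * x ^+ 2) +
  trF (x ^+ (2 * q - 1)).

Lemma f2_eval g x : (f2 q c1 c2 c3 g).[x] = x + g * (f2_trace x)%:L.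
Proof.
rewrite /f2 /qtrace.
rewrite !(hornerD, hornerM, horner_exp, hornerXn, hornerX, hornerC).
congr (_ + _ * _).
rewrite /f2_trace -trFZ -!trFD trFE.
have -> : c1 * x + c2 * x ^+ 2 + (trF x)%:L * (c3 * x ^+ 2) + x ^+ (2 * q - 1) =
    c1 * x + c2 * x ^+ 2 + c3 * x ^+ 3 + c3 * x ^+ (q + 2) + x ^+ (2 * q - 1).
  by rewrite trFE exprD; ring.
by [].
Qed.

(** Two points with the same image differ by u g for some u in F, namely the
    difference of the values of the trace. *)
Lemma permutation_criterion g : g != 0 ->
  permutation_poly (f2 q c1 c2 c3 g) <->
  (forall x u, u != 0 -> f2_trace (x + u%:L * g) + f2_trace x + u != 0).
Proof.
have twoF := two_eq0 cardF.
move=> g0; split=> [/bij_inj f_inj x u u0|H].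
  apply/eqP => e; move: u0; apply/negP/negPn.
  have {e} uE : f2_trace x = f2_trace (x + u%:L * g) + u.
    by rewrite -[LHS]addr0 -e; ring2 twoF.
  suff /addrI/esym/eqP : x + 0 = x + u%:L * g.
    by rewrite mulf_eq0 (negbTE g0) orbF fmorph_eq0.
  by rewrite addr0; apply: f_inj; rewrite !f2_eval uE rmorphD /=; ring2 two0.
have f_inj : injective (fun x => (f2 q c1 c2 c3 g).[x]).
  move=> x y; rewrite !f2_eval => e.
  pose u := f2_trace x + f2_trace y.
  have yE : y = x + u%:L * g.
    apply/eqP; rewrite -addr_eq0E; apply/eqP.
    have -> : y + (x + u%:L * g) =
        x + g * (f2_trace x)%:L + (y + g * (f2_trace y)%:L).
      by rewrite /u rmorphD /=; ring2 two0.
    by rewrite e addxx.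
  have [u0|u0] := eqVneq u 0.
    by rewrite [RHS]yE u0 rmorph0 mul0r addr0.
  have := H x u u0; rewrite -yE /u.
  have -> : f2_trace y + f2_trace x + (f2_trace x + f2_trace y) = 0 by ring2 twoF.
  by rewrite eqxx.
exact: (@injF_bij (finvect_type L) _ f_inj).
Qed.

Lemma f2_trace_shift x v :
  f2_trace (x + v%:L) + f2_trace x =
  v * trF c1 + v ^+ 2 * trF c2 + trF x * v ^+ 2 * trF c3 +
  (trF ((x + v%:L) ^+ (2 * q - 1)) + trF (x ^+ (2 * q - 1))).
Proof.
have twoF := two_eq0 cardF.
have trFx : trF (x + v%:L) = trF x.
  rewrite trFD; have /eqP -> : trF v%:L == 0 by rewrite trF_eq0 inL_mem.
  by rewrite addr0.
have sq : (x + v%:L) ^+ 2 = x ^+ 2 + (v ^+ 2)%:L by rewrite rmorphXn; ring2 two0.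
rewrite /f2_trace trFx sq !mulrDr !trFD !trFZr.
ring2 twoF.
Qed.

(** Every term of the trace is homogeneous in a scalar v of F, the last one of
    degree 1 because v^(2q-1) = v. *)
Lemma f2_trace_scaled z g v :
  f2_trace (v%:L * (z + g)) + f2_trace (v%:L * z) =
  v * (trF (c1 * g) + v * trF (c2 * g ^+ 2) +
       v ^+ 2 * (trF (z + g) * trF (c3 * (z + g) ^+ 2) + trF z * trF (c3 * z ^+ 2)) +
       (trF ((z + g) ^+ (2 * q - 1)) + trF (z ^+ (2 * q - 1)))).
Proof.
have twoF := two_eq0 cardF.
have q_gt0 : (0 < q)%N by rewrite expn_gt0.
have vq : v ^+ (2 * q - 1) = v.
  have [->|v0] := eqVneq v 0.
    by rewrite expr0n; have /negbTE -> : (2 * q - 1 != 0)%N by lia.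
  apply: (mulIf v0); rewrite -exprSr; have -> : (2 * q - 1).+1 = (q * 2)%N by lia.
  by rewrite exprM (exp_card cardF) expr2.
have inner_v y : f2_trace (v%:L * y) = v * trF (c1 * y) + v ^+ 2 * trF (c2 * y ^+ 2) +
   v ^+ 3 * (trF y * trF (c3 * y ^+ 2)) + v * trF (y ^+ (2 * q - 1)).
  rewrite /f2_trace !exprMn -!rmorphXn vq !(mulrCA _ _%:L) !trFZ; ring.
have sq : (z + g) ^+ 2 = z ^+ 2 + g ^+ 2 by ring2 two0.
rewrite !inner_v !sq !mulrDr !trFD.
ring2 twoF.
Qed.

Hypothesis m_gt1 : (1 < m)%N.

Lemma permutation_rational (g : F) : g != 0 ->
  permutation_poly (f2 q c1 c2 c3 g%:L) <->
  [/\ trF c1 + g^-1 = 1, trF c2 = 0 & trF c3 = 0].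
Proof.
have twoF := two_eq0 cardF.
move=> g0; have [z z1] := exists_irrational.
have [_ [w [n [_ _ w_gen]]]] := irrational_scaled z1.
have n1 : tr n = 1 by case: w_gen.
apply: iff_trans
  (rational_direction cardF (trF c1 + g^-1) (trF c2) (trF c3) m_gt1 n1).
apply: iff_trans (permutation_criterion _) _; first by rewrite fmorph_eq0.
have key a b v :
    f2_trace (a%:L + b%:L * w + v%:L) + f2_trace (a%:L + b%:L * w) + v / g =
    (trF c1 + g^-1) * v + trF c2 * v ^+ 2 + b * trF c3 * v ^+ 2 +
    (b ^+ 3 / qnorm n (a + v) b + b ^+ 3 / qnorm n a b).
  rewrite f2_trace_shift (trF_coord w_gen).
  have -> : a%:L + b%:L * w + v%:L = (a + v)%:L + b%:L * w by rewrite rmorphD addrAC.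
  by rewrite !(trF_tail w_gen); ring2 twoF.
split=> [H a b v v0|H x u u0].
  rewrite -key; have := H (a%:L + b%:L * w) (v / g) (mulf_neq0 v0 (invr_neq0 g0)).
  by rewrite -rmorphM divfK.
have [a [b ->]] := coordinates w_gen x.
have := H a b (u * g) (mulf_neq0 u0 g0).
by rewrite -key mulfK // rmorphM.
Qed.

Lemma permutation_irrational (t n : F) (w : L) :
  t != 0 -> artin_schreier_gen w n ->
  permutation_poly (f2 q c1 c2 c3 (t%:L * w)) <->
  [/\ trF (c1 * w) + t^-1 + 1 = 0, n = 1, trF (c2 * w ^+ 2) = 0 &
     trF c3 = 0 /\ trF (c3 * w ^+ 2) = 0].
Proof.
have twoF := two_eq0 cardF.
move=> t0 w_gen; have [w1 w2 _ n1] := w_gen.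
have w0 : w != 0 by apply: contraNneq w1 => ->; rewrite mem0v.
apply: iff_trans
  (irrational_direction cardF (trF (c1 * w) + t^-1 + 1) (trF (c2 * w ^+ 2))
    (trF c3) (trF (c3 * w ^+ 2)) m_gt1 n1).
apply: iff_trans (permutation_criterion _) _.
  by rewrite mulf_neq0 ?fmorph_eq0.
have key A b v : v != 0 ->
    f2_trace (v%:L * (A%:L + b%:L * w) + (v / t)%:L * (t%:L * w)) +
      f2_trace (v%:L * (A%:L + b%:L * w)) + v / t =
    v * (trF (c1 * w) + t^-1 + 1 + cubic_ratio n A b + v * trF (c2 * w ^+ 2)
       + v ^+ 2 * (trF c3 * A ^+ 2 + trF (c3 * w ^+ 2) * (b ^+ 2 + b + 1))).
  move=> v0; rewrite mulrA -rmorphM divfK // -mulrDr f2_trace_scaled.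
  have -> : A%:L + b%:L * w + w = A%:L + (b + 1)%:L * w.
    by rewrite rmorphD rmorph1; ring.
  have sq c : trF (c3 * (A%:L + c%:L * w) ^+ 2) =
      A ^+ 2 * trF c3 + c ^+ 2 * trF (c3 * w ^+ 2).
    rewrite -!trFZ -trFD; congr trF; rewrite !rmorphXn; ring2 two0.
  rewrite !sq !(trF_coord w_gen) !(trF_tail w_gen) /cubic_ratio.
  ring2 twoF.
split=> [H A b v v0|H x u u0].
  have := H (v%:L * (A%:L + b%:L * w)) (v / t) (mulf_neq0 v0 (invr_neq0 t0)).
  by rewrite key // mulf_eq0 negb_or => /andP[].
have ut0 := mulf_neq0 u0 t0; have utL0 : (u * t)%:L != 0 by rewrite fmorph_eq0.
have [A [b xE]] := coordinates w_gen (x / (u * t)%:L).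
have {xE} -> : x = (u * t)%:L * (A%:L + b%:L * w) by rewrite -xE mulrC divfK.
have := key A b _ ut0; rewrite mulfK // => ->.
by rewrite mulf_neq0 ?H.
Qed.

End Criterion.

End QuadraticExtension.

(** * The classification *)

(* F is F_q and L is its quadratic extension F_{q^2}; the copy of F_q inside L
   is the one-dimensional subspace 1%VS. *)
Theorem theorem3p8 (m q : nat) (hm : (1 < m)%N) (hq : q = (2 ^ m)%N)
    (F : finFieldType) (hF : #|F| = q)
    (L : fieldExtType F) (hL : \dim {: L} = 2%N)
    (c1 c2 c3 gamma : L) :
  permutation_poly (f2 q c1 c2 c3 gamma) <->
  [\/ gamma = 0,
      [/\ gamma \in 1%VS, gamma != 0, c2 \in 1%VS, c3 \in 1%VS
        & 1 + gamma * qtrace q c1 = gamma]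
    | [/\ gamma \notin 1%VS, odd m, gamma ^+ (2 * q - 1) \in 1%VS,
          qtrace q (c2 * gamma ^+ q) = 0
        & c3 = 0 /\ 1 + qtrace q (c1 * gamma) = gamma ^+ (2 * q - 1)]].
Proof.
subst q; have cardF := hF.
pose inL : {rmorphism F -> L} := in_alg L.
have inLE a : inL a = a%:A by [].
have twoF := two_eq0 cardF.
have two0 : (2 : L) = 0 by rewrite -(rmorph_nat inL 2) twoF rmorph0.
move: inL inLE => inL inLE.
have qtrE (x : L) : qtrace (2 ^ m) x = inL (trF m inL x).
  by rewrite (trFE cardF hL inLE).
have [g0|g0] := eqVneq gamma 0.
  split=> _; first by apply: Or31.
  by rewrite g0; exists id => x; rewrite (f2_eval cardF hL inLE) mul0r addr0.
have [gF|gF] := boolP (gamma \in 1%VS).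
  have [g gE] : exists g, gamma = inL g.
    by case/vlineP: gF => g ->; exists g; rewrite inLE.
  have gn0 : g != 0 by move: g0; rewrite gE fmorph_eq0.
  rewrite {1}gE.
  apply: iff_trans (permutation_rational cardF hL inLE _ _ _ hm gn0) _.
  have c1E : 1 + gamma * qtrace (2 ^ m) c1 = gamma <-> trF m inL c1 + g^-1 = 1.
    rewrite qtrE gE -(rmorph1 inL) -rmorphM -rmorphD.
    split=> [/(fmorph_inj inL) e|e].
      by apply: (mulfI gn0); rewrite mulr1 mulrDr mulfV // addrC.
    by congr (inL _); rewrite -[RHS]mulr1 -[in RHS]e mulrDr mulfV // addrC.
  split=> [[/c1E e1 e2 e3]|[g00|[_ _ e2 e3 /c1E e1]|[]]].
  - by apply: Or32; split=> //; rewrite -(trF_eq0 cardF hL inLE) ?e2 ?e3 eqxx.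
  - by rewrite g00 eqxx in g0.
  - split=> //; apply/eqP; by rewrite (trF_eq0 cardF hL inLE).
  - done.
have [t [w [n [t0 gE w_gen]]]] := irrational_scaled cardF hL inLE gF.
have [w1 w2 wq n1] := w_gen.
rewrite {1}gE.
apply: iff_trans (permutation_irrational cardF hL inLE _ _ _ hm t0 w_gen) _.
pose T := trF m inL.
have w0 : w != 0 by apply: contraNneq w1 => ->; rewrite mem0v.
have tL0 : inL t != 0 by rewrite fmorph_eq0.
have q_gt0 : (0 < 2 ^ m)%N by rewrite expn_gt0.
have gammaq : gamma ^+ (2 ^ m) = inL t * (w + 1).
  by rewrite gE exprMn (inL_frob cardF inLE) wq.
(* From gamma^q = t (w + 1) and (w + 1)^2 = w + n + 1. *)
have tail : gamma ^+ (2 * 2 ^ m - 1) * w = inL t * (w + inL n + 1).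
  apply: (mulIf tL0); rewrite -mulrA [w * _]mulrC -gE -exprSr.
  have -> : (2 * 2 ^ m - 1).+1 = (2 ^ m * 2)%N by lia.
  rewrite exprM gammaq -[w + inL n]w2; ring2 two0.
have tail_n1 : n = 1 -> gamma ^+ (2 * 2 ^ m - 1) = inL t.
  move=> n_1; apply: (mulIf w0); rewrite tail n_1 rmorph1; ring2 two0.
have n1_tail : gamma ^+ (2 * 2 ^ m - 1) \in 1%VS -> n = 1.
  case/vlineP => a; rewrite -inLE => aE; rewrite aE in tail.
  have at_w : inL (a + t) * w = inL (t * (n + 1)).
    have -> : inL (a + t) * w = inL a * w + inL t * w by rewrite rmorphD mulrDl.
    by rewrite tail; ring2 two0.
  have [at0|at0] := eqVneq (a + t) 0.
    move/esym/eqP: at_w; rewrite at0 rmorph0 mul0r fmorph_eq0.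
    by rewrite mulf_eq0 (negbTE t0) (addr_eq0E twoF) => /eqP.
  case/negP: w1; rewrite -[w](mulKf (_ : inL (a + t) != 0)) ?fmorph_eq0 //.
  by rewrite at_w -fmorphV -rmorphM (inL_mem inLE).
have c1E : n = 1 -> 1 + qtrace (2 ^ m) (c1 * gamma) = gamma ^+ (2 * 2 ^ m - 1) <->
    T (c1 * w) + t^-1 + 1 = 0.
  move=> /tail_n1 ->; rewrite qtrE gE mulrCA (trFZ cardF hL inLE) -/T.
  rewrite -(rmorph1 inL) -rmorphD; split=> [/(fmorph_inj inL) e|e].
    apply: (mulfI t0); rewrite mulr0 !mulrDr mulfV // mulr1 -[X in _ + X]e.
    by ring2 twoF.
  congr (inL _); rewrite -[LHS]addr0 -(mulr0 t) -e !mulrDr mulfV // mulr1.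
  by ring2 twoF.
have c2E : n = 1 ->
    qtrace (2 ^ m) (c2 * gamma ^+ (2 ^ m)) = 0 <-> T (c2 * w ^+ 2) = 0.
  move=> n_1; rewrite qtrE gammaq mulrCA (trFZ cardF hL inLE) w2 n_1 rmorph1 -/T.
  rewrite rmorphM; split=> [/eqP|->]; last by rewrite rmorph0 mulr0.
  by rewrite mulf_eq0 (negbTE tL0) fmorph_eq0 => /eqP.
have c3E : c3 = 0 <-> T c3 = 0 /\ T (c3 * w ^+ 2) = 0.
  split=> [->|[/eqP]].
    by rewrite mul0r; split; apply/eqP; rewrite (trF_eq0 cardF hL inLE) mem0v.
  rewrite (trF_eq0 cardF hL inLE) => /vlineP[d ->].
  rewrite -inLE /T (trFZ cardF hL inLE).
  have -> : w ^+ 2 = inL n + inL 1 * w by rewrite w2 rmorph1 mul1r addrC.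
  by rewrite (trF_coord cardF hL inLE w_gen) mulr1 => ->; rewrite rmorph0.
(* The trace of 1 is m times 1. *)
have odd_m : n = 1 -> odd m.
  move=> n_1; apply: contraT => even_m.
  have : tr m (1 : F) = 0.
    rewrite /tr; under eq_bigr do rewrite expr1n.
    rewrite sumr_const card_ord -[m]odd_double_half (negbTE even_m) add0n.
    by rewrite -mul2n mulrnA twoF mul0rn.
  by rewrite -n_1 n1 => /eqP; rewrite oner_eq0.
split=> [[e1 n_1 e2 e3]|[g00|[gF1 _ _ _ _]|[_ _ /n1_tail n_1 e2 [e3 e1]]]].
- apply: Or33; split=> //; first exact: odd_m.
  + by rewrite tail_n1 // (inL_mem inLE).
  + exact/(c2E n_1).
  + by split; [apply/c3E | apply/(c1E n_1)].
- by rewrite g00 eqxx in g0.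
- by [].
- by split=> //; [apply/(c1E n_1) | apply/(c2E n_1) | apply/c3E].
Qed.
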